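(* Let $M$ be a discrete $m$-function whose sequence of continued fraction coefficients is eventually periodic, written as \[ \{(\alpha_1,\beta_1),\ldots,(\alpha_k,\beta_k),\overline{(a_1,b_1),\ldots,(a_p,b_p)}\} \] (with $k\ge 1$, and the overline meaning the block $(a_1,b_1),\ldots,(a_p,b_p)$ repeats forever), and assume $(\alpha_k,\beta_k)=(a_p,b_p)$. Let $\widetilde M$ be the second solution associated to $M$. Let $\ell\in\{1,\ldots,p-2\}$. Then the periodic sequence $\{(a_j,b_j)\}_{j\ge1}$ (extended $p$-periodically) is doubly palindromic with period $p$ and first length $\ell$ if and only if \[ \frac{1}{\alpha_k^2\widetilde M(z)}=f_{T_3T_2T_1}(M(z)), \] where, setting $\alpha_0:=\alpha_k$, \[ T_1=\begin{pmatrix} p_k(z;\{\alpha_j,\beta_j\}_{j=1}^k) & q_k(z;\{\alpha_j,\beta_j\}_{j=1}^k)\\ -\alpha_k p_{k-1}(z;\{\alpha_j,\beta_j\}_{j=1}^k) & -\alpha_k q_{k-1}(z;\{\alpha_j,\beta_j\}_{j=1}^k)\end{pmatrix}, \] \[ T_2=\begin{pmatrix} p_{\ell+1}(z;\{a_j,b_j\}_{j=1}^{\ell+1}) & q_{\ell+1}(z;\{a_j,b_j\}_{j=1}^{\ell+1})\\ -a_{\ell+1} p_{\ell}(z;\{a_j,b_j\}_{j=1}^{\ell+1}) & -a_{\ell+1} q_{\ell}(z;\{a_j,b_j\}_{j=1}^{\ell+1})\end{pmatrix}, \] \[ T_3=\begin{pmatrix} p_k(z;\{\alpha_{k-j},\beta_{k-j+1}\}_{j=1}^k)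 & q_k(z;\{\alpha_{k-j},\beta_{k-j+1}\}_{j=1}^k)\\ -\alpha_k p_{k-1}(z;\{\alpha_{k-j},\beta_{k-j+1}\}_{j=1}^k) & -\alpha_k q_{k-1}(z;\{\alpha_{k-j},\beta_{k-j+1}\}_{j=1}^k)\end{pmatrix}. \] (Here $\{\alpha_{k-j},\beta_{k-j+1}\}_{j=1}^k$ denotes the coefficient list $(\alpha_{k-1},\beta_k),(\alpha_{k-2},\beta_{k-1}),\ldots,(\alpha_1,\beta_2),(\alpha_k,\beta_1)$.)
   Context: A discrete $m$-function is a function $m(z)=\int\frac{d\rho(x)}{x-z}$ on $\mathbb{C}_+=\{z:\operatorname{Im} z>0\}$, where $\rho$ is a probability measure on $\mathbb{R}$ with compact support. Such $m$ has a unique continued fraction expansion \[ m(z)=\cfrac{1}{b_1-z-\cfrac{a_1^2}{b_2-z-\cfrac{a_2^2}{b_3-z-\cdots}}} \] valid on $\mathbb{C}_+$, with bounded sequences $a_n>0$, $b_n\in\mathbb{R}$; the pairs $\{(a_n,b_n)\}_{n\ge1}$ are its continued fraction coefficients, and conversely every such bounded sequence arises from a unique discrete $m$-function. Orthogonal polynomials: given $a_1,a_2,\ldots>0$, $b_1,b_2,\ldots\in\mathbb{R}$, set $p_{-1}=0$, $p_0=1$ and define $p_{n+1}$ by $zp_n(z)=a_{n+1}p_{n+1}(z)+b_{n+1}p_n(z)+a_np_{n-1}(z)$ for $n\ge0$. The polynomial $p_n$ depends only on $(a_1,b_1),\ldots,(a_n,b_n)$; write $p_n(z;\{a_j,b_j\}_{j=1}^N)$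 for it whenever $N\ge n$ coefficient pairs are listed (only the first $n$ are used). Second kind polynomials: $q_{-1}=-1$, $q_0=0$, and for $n\ge1$, $q_n(z;\{a_j,b_j\}_{j=1}^N)=\frac{1}{a_1}p_{n-1}(z;\{a_{j},b_{j}\}_{j=2}^N)$, i.e. $\frac1{a_1}$ times the degree $n-1$ polynomial built from the shifted list $(a_2,b_2),(a_3,b_3),\ldots$. For a $2\times 2$ matrix $T=\begin{pmatrix}a&b\\c&d\end{pmatrix}$, $f_T(w)=\frac{aw+b}{cw+d}$. Second solution: if the coefficients of $M$ are eventually periodic, there are polynomials $A,B,C\in\mathbb{R}[z]$, $A\ne0$, with $A(z)M(z)^2+B(z)M(z)+C(z)=0$ on $\mathbb{C}_+$ (take such a relation of minimal degree in $M$; $M$ is not a rational function); the second solution is the other root $\widetilde M(z)=-B(z)/A(z)-M(z)$. Doubly palindromic: $p$-periodic sequences $\{a_j\},\{b_j\}$ (i.e. $a_{j+p}=a_j$, $b_{j+p}=b_j$) form a sequence $\{(a_j,b_j)\}$ that is doubly palindromic with period $p$ and first length $\ell$ (where $1\le\ell\le p-2$) if the word $a_1a_2\cdots a_p$ is the concatenation of a palindrome of length $\ell$ and a palindrome of length $p-\ell$, and the word $b_1b_2\cdots b_p$ is the concatenation of a palindrome of length $\ell+1$ and a palindrome of length $p-\ell-1$. *)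

(* Defs.v *)
From mathcomp Require Import all_boot all_algebra.
From mathcomp Require Import complex.
From mathcomp Require Import reals.
Set Implicit Arguments. Unset Strict Implicit. Unset Printing Implicit Defensive.
Import GRing.Theory Num.Theory.
Local Open Scope ring_scope.
Local Open Scope complex_scope.

Section Defs.
Variable R : realType.
Local Notation C := R[i].

(* Coefficient sequences are functions nat -> R, indexed from 1
   (the value at index 0 is never used). *)
Definition shift1 (f : nat -> R) : nat -> R := fun j => f j.+1.

Fixpoint cf_trunc (a b : nat -> R) (n : nat) (z : C) : C :=
  match n with
  | 0 => 0
  | n'.+1 => 1 / ((b 1)%:C - z - ((a 1) ^+ 2)%:C * cf_trunc (shift1 a) (shift1 b) n' z)
  end.

Definition cvg_C (u : nat -> C) (L : C) : Prop :=
  forall e : C, 0 < e -> exists N : nat, forall n : nat, (N <= n)%N -> `|u n - L| < e.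

Definition is_m_function_of (a b : nat -> R) (M : C -> C) : Prop :=
  forall z : C, 0 < 'Im z -> cvg_C (fun n => cf_trunc a b n z) (M z).

Definition evper (k p : nat) (al a : nat -> R) : nat -> R :=
  fun n => if (n <= k)%N then al n else a ((n - k).-1 %% p).+1.

(* Orthogonal polynomials evaluated at z: returns (p_n(z), p_{n-1}(z)),
   with p_{-1} = 0, p_0 = 1, and
   z p_n = a_{n+1} p_{n+1} + b_{n+1} p_n + a_n p_{n-1}. *)
Fixpoint opoly_pair (a b : nat -> R) (n : nat) (z : C) : C * C :=
  match n with
  | 0 => (1, 0)
  | n'.+1 =>
      let: (pn, pn1) := opoly_pair a b n' z in
      (((z - (b n)%:C) * pn - (a n')%:C * pn1) / (a n)%:C, pn)
  end.

Definition opoly (a b : nat -> R) (n : nat) (z : C) : C := (opoly_pair a b n z).1.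

Definition qpoly (a b : nat -> R) (n : nat) (z : C) : C :=
  match n with
  | 0 => 0
  | n'.+1 => (a 1)%:C^-1 * opoly (shift1 a) (shift1 b) n' z
  end.

Definition Tmat (a b : nat -> R) (n : nat) (c : R) (z : C) : 'M[C]_2 :=
  \matrix_(i < 2, j < 2)
    if (i == 0 :> nat) then
      (if (j == 0 :> nat) then opoly a b n z else qpoly a b n z)
    else
      (if (j == 0 :> nat) then - c%:C * opoly a b n.-1 z
       else - c%:C * qpoly a b n.-1 z).

Definition mobius (T : 'M[C]_2) (w : C) : C :=
  (T 0 0 * w + T 0 1) / (T 1 0 * w + T 1 1).

Definition mobius_den (T : 'M[C]_2) (w : C) : C := T 1 0 * w + T 1 1.

Definition palindrome (s : seq R) : bool := s == rev s.

Definition word (p : nat) (a : nat -> R) : seq R := mkseq (fun i => a i.+1) p.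

Definition doubly_palindromic (p l : nat) (a b : nat -> R) : bool :=
  [&& palindrome (take l (word p a)), palindrome (drop l (word p a)),
      palindrome (take l.+1 (word p b)) & palindrome (drop l.+1 (word p b))].

Definition pevalC (P : {poly R}) (z : C) : C := (map_poly (real_complex R) P).[z].

End Defs.

(* Main.v *)
Require Import Defs.
From mathcomp Require Import all_boot all_order all_algebra.
From mathcomp Require Import complex.
From mathcomp Require Import reals.
From mathcomp Require Import ring zify.
Set Implicit Arguments. Unset Strict Implicit. Unset Printing Implicit Defensive.
Import Order.TTheory GRing.Theory Num.Theory.
Local Open Scope ring_scope.
Local Open Scope complex_scope.

(* Write the transfer matrix of a coefficient list as a product of one-step
   matrices over R[z], and let K_x be the matrix of w |-> 1 / (x^2 w).  With P the
   transfer matrix of one period, M and its second solution are the two fixed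
   points of Q = T1^-1 P T1.  They are irrational, so the Moebius identity
   amounts to polynomial identities: K T with T = T3 T2 T1 exchanges the fixed
   points of Q exactly when tr (K T) = 0 and tr (K T Q) = 0.  A one-step
   computation gives T1 K T3 = K, which turns these into tr (K T2) = 0 and
   tr (K T2 P) = 0.  Finally tr (V K) = 0 for a transfer matrix V says that V K
   is an involution; since the factorization of V into one-step matrices is
   unique, this means that the coefficient word of V is a palindrome. *)

(** * Two-by-two matrices in coordinates *)

Definition mx2 {T : Type} (a b c d : T) : 'M[T]_2 :=
  \matrix_(i, j) if i == 0 then (if j == 0 then a else b)
                 else (if j == 0 then c else d).

Lemma mx2_eta {T : Type} (X : 'M[T]_2) : X = mx2 (X 0 0) (X 0 1) (X 1 0) (X 1 1).
Proof.
by apply/matrixP; do 2![case; case=> [|[|//]] ?]; rewrite !mxE /=; congr (X _ _);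
  apply/val_inj.
Qed.

Lemma mx2E {T : Type} (a b c d : T) :
  (mx2 a b c d 0 0 = a) * (mx2 a b c d 0 1 = b) *
  (mx2 a b c d 1 0 = c) * (mx2 a b c d 1 1 = d).
Proof. by rewrite !mxE. Qed.

Section Mx2Ring.
Variable S : comNzRingType.
Implicit Types a b c d : S.

Lemma mulmx2 a b c d a' b' c' d' : mx2 a b c d *m mx2 a' b' c' d' =
  mx2 (a * a' + b * c') (a * b' + b * d') (c * a' + d * c') (c * b' + d * d').
Proof.
rewrite [LHS]mx2_eta; congr mx2; rewrite mxE big_ord_recl big_ord1 /=;
  by rewrite (_ : lift ord0 ord0 = 1) ?mx2E //; apply/val_inj.
Qed.

Lemma mx2_1 : 1%:M = mx2 1 0 0 1 :> 'M[S]_2.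
Proof. by rewrite [LHS]mx2_eta !mxE. Qed.

Lemma trmx2 a b c d : \tr (mx2 a b c d) = a + d.
Proof.
by rewrite /mxtrace big_ord_recl big_ord1 !mxE.
Qed.

Lemma detmx2 a b c d : \det (mx2 a b c d) = a * d - b * c.
Proof.
rewrite (expand_det_row _ 0) big_ord_recl big_ord1 /cofactor !det_mx11 !mxE /=.
rewrite expr0 expr1; ring.
Qed.

Lemma Cayley_Hamilton_mx2 (X : 'M[S]_2) : X *m X = \tr X *: X - (\det X)%:M.
Proof.
rewrite (mx2_eta X) mulmx2 trmx2 detmx2 [RHS]mx2_eta !mxE /= !mulr1n !mulr0n.
by congr mx2; ring.
Qed.
End Mx2Ring.

Lemma map_mx2 {T T' : Type} (f : T -> T') a b c d :
  map_mx f (mx2 a b c d) = mx2 (f a) (f b) (f c) (f d).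
Proof. by rewrite [LHS]mx2_eta !mxE. Qed.

(** * Transfer matrices over [R[z]]: reversal, degrees, unique factorization *)

Section Transfer.
Variable R : realFieldType.
Implicit Types (a b c d : nat -> R) (n : nat).

(** Maps the column [(p_n, - a_n p_(n-1))] to the next one; the factor [- a_n] lets the matrix
    depend on a single pair. As a Moebius map it sends an m-function with first pair [(x, y)] to
    that of the shifted coefficients. *)
Definition step (x y : R) : 'M[{poly R}]_2 :=
  mx2 (x^-1 *: ('X - y%:P)) (x^-1)%:P (- x)%:P 0.

Fixpoint transfer a b n : 'M[{poly R}]_2 :=
  if n is m.+1 then step (a m.+1) (b m.+1) *m transfer a b m else 1%:M.

(** The matrix [K_x] of [w |-> 1 / (x^2 w)], scaled to determinant [-1]. *)
Definition flip (x : R) : 'M[{poly R}]_2 := mx2 0 (x^-1)%:P x%:P 0.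

Lemma transferS a b n :
  transfer a b n.+1 = step (a n.+1) (b n.+1) *m transfer a b n.
Proof. by []. Qed.

Lemma eq_transfer a b a' b' n :
  (forall j, (1 <= j <= n)%N -> a j = a' j) ->
  (forall j, (1 <= j <= n)%N -> b j = b' j) -> transfer a b n = transfer a' b' n.
Proof.
elim: n => // n IH ha hb; rewrite !transferS ha ?hb ?IH ?ltnSn // => j /andP[j1 jn].
  by rewrite ha // j1 leqW.
by rewrite hb // j1 leqW.
Qed.

Lemma transfer_add a b m n : transfer a b (m + n) =
  transfer (fun j => a (j + n)%N) (fun j => b (j + n)%N) m *m transfer a b n.
Proof.
by elim: m => [|m IH]; rewrite ?mul1mx // addSn !transferS IH mulmxA addSn.
Qed.

Lemma transferSr a b n :
  transfer a b n.+1 = transfer (fun j => a j.+1) (fun j => b j.+1) n *m step (a 1) (b 1).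
Proof.
have := transfer_add a b n 1; rewrite addn1 [transfer _ _ 1]/= mulmx1 => ->.
by congr (_ *m _); apply: eq_transfer => j _; rewrite addn1.
Qed.

Lemma det_transfer a b n : (forall j, (1 <= j <= n)%N -> a j != 0) ->
  \det (transfer a b n) = 1.
Proof.
elim: n => [|n IH] ha; first by rewrite det1.
rewrite transferS det_mulmx IH => [|j /andP[j1 jn]]; last by rewrite ha // j1 leqW.
rewrite detmx2 mulr0 sub0r mulr1 -polyCM mulrN mulVf ?ha ?ltnSn //.
by rewrite polyCN opprK.
Qed.

Lemma flip_sq (x y : R) : flip x *m flip y = mx2 (x^-1 * y)%:P 0 0 (x * y^-1)%:P.
Proof. by rewrite mulmx2 !polyCM; congr mx2; ring. Qed.

(** In Moebius terms, [step x y] followed by [flip x] is [m |-> 1 / (y - z - 1 / m)], where [x] has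
    cancelled, and [step x' y] takes this to [1 / (x'^2 m)]. *)
Lemma step_flip_step (x x' y : R) : x != 0 -> x' != 0 ->
  step x' y *m flip x *m step x y = flip x'.
Proof.
move=> x0 x'0; rewrite !mulmx2.
have E : x^-1%:P * x%:P = 1 :> {poly R} by rewrite -polyCM mulVf.
rewrite -!mul_polyC !polyCN; congr mx2.
- ring: E.
- ring: E.
- ring: E.
- ring.
Qed.

(** Telescopes from the middle outwards by [step_flip_step]. There the two steps share their second
    entry while the right one takes its first entry from the flip, whence the offset between [c] and
    [d] in the reversed list. *)
Lemma transfer_flip c d n : (forall j, (j <= n)%N -> c j != 0) ->
  transfer c d n *m flip (c 0) *m
  transfer (fun j => c (n - j)%N) (fun j => d (n - j).+1) n = flip (c n).
Proof.
elim: n => [|n IH] hc; first by rewrite mul1mx mulmx1.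
rewrite [X in _ *m X]transferSr transferS subSS subn0.
rewrite -(step_flip_step (d n.+1) (hc n _) (hc n.+1 _)) // -IH => [|j jn]; first by rewrite !mulmxA.
by rewrite hc // leqW.
Qed.

Lemma coef_step (x y : R) (u v : {poly R}) j :
  (x^-1 *: ('X - y%:P) * u + x^-1%:P * v)`_j.+1 =
  x^-1 * (u`_j - y * u`_j.+1 + v`_j.+1).
Proof.
by rewrite coefD -scalerAl coefZ mulrBl coefB coefXM !coefCM /=; ring.
Qed.

Lemma size_step (x y : R) (u v : {poly R}) n :
  (size u <= n.+1)%N -> (size v <= n.+2)%N ->
  (size (x^-1 *: ('X - y%:P) * u + x^-1%:P * v)%R <= n.+2)%N.
Proof.
move=> /leq_sizeP su /leq_sizeP sv; apply/leq_sizeP => -[//|j jn].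
by rewrite coef_step su ?su ?sv ?mulr0 ?subr0 ?addr0 ?mulr0 // ltnW.
Qed.

(** The upper left entry strictly dominates its column in degree, so coefficients can be read off
    from leading terms. *)
Lemma transfer_degree a b n : (forall j, (1 <= j <= n)%N -> 0 < a j) ->
  let V := transfer a b n in
  [/\ 0 < (V 0 0)`_n, (size (V 0 0)%R <= n.+1)%N, (size (V 1 0)%R <= n)%N,
      (size (V 0 1)%R <= n)%N & (size (V 1 1)%R <= n.+1)%N].
Proof.
elim: n => [|n IH] ha; first by rewrite /= mx2_1 !mx2E coefC /= ltr01 size_poly0 size_poly1.
have [|lu su sv sw sx] := IH.
  by move=> j /andP[j1 jn]; apply: ha; rewrite j1 leqW.
move: lu su sv sw sx; rewrite /=; set V := transfer a b n => lu su sv sw sx.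
have an : 0 < a n.+1 by rewrite ha // ltnSn.
rewrite (mx2_eta V) mulmx2 !mx2E !mul0r !addr0; split.
- rewrite coef_step mulr_gt0 ?invr_gt0 // (leq_sizeP _ _ su n.+1) //.
  by rewrite (leq_sizeP _ _ sv) // mulr0 subr0 addr0.
- by apply: size_step => //; rewrite (leq_trans sv) // ltnW.
- by rewrite mul_polyC (leq_trans (size_scale_leq _ _)).
- case: (n) @V lu su sv sw sx => [|m] V lu su sv sw sx; last exact: size_step.
  by rewrite /V /= mx2_1 !mx2E mulr0 add0r mulr1 size_polyC leq_b1.
- by rewrite mul_polyC (leq_trans (size_scale_leq _ _)) // (leq_trans sw) // ltnW.
Qed.

(** The lower right entry is a constant multiple of the upper right entry one step earlier, so it
    cannot cancel the leading term of the upper left one. *)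
Lemma size_trace_transfer a b n : (0 < n)%N -> (forall j, (1 <= j <= n)%N -> 0 < a j) ->
  (1 < size (\tr (transfer a b n)))%N.
Proof.
case: n => // n _ ha; rewrite ltnNge; apply/negP => /leq_sizeP/(_ n.+1 isT).
rewrite {1}(mx2_eta (transfer a b n.+1)) trmx2 coefD.
have [lu _ _ _ _] := @transfer_degree a b _ ha.
have [|_ _ _ s01 _] := @transfer_degree a b n.
  by move=> j /andP[j1 jn]; apply: ha; rewrite j1 leqW.
rewrite [in X in _ + X]transferS [X in step _ _ *m X]mx2_eta mulmx2 !mx2E mul0r addr0.
rewrite coefCM (leq_sizeP _ _ s01) // mulr0 addr0 => E.
by rewrite E ltxx in lu.
Qed.

(** [flip x] with its columns exchanged. It records the value [c 0], which does not enter
    [transfer c d n]. *)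
Definition dilation (x : R) : 'M[{poly R}]_2 := mx2 (x^-1)%:P 0 0 x%:P.

(* Peels off the leftmost factors: comparing leading coefficients in the first
   column gives [c n], and then [d n] is the next coefficient. *)
Lemma transfer_dilation_inj c d c' d' n :
  (forall j, (j <= n)%N -> 0 < c j) -> (forall j, (j <= n)%N -> 0 < c' j) ->
  transfer c d n *m dilation (c 0%N) = transfer c' d' n *m dilation (c' 0%N) ->
  (forall j, (j <= n)%N -> c j = c' j) /\
  (forall j, (1 <= j <= n)%N -> d j = d' j).
Proof.
move=> hc hc' E.
have: (transfer c d n *m dilation (c 0%N)) 0 0 = (transfer c' d' n *m dilation (c' 0%N)) 0 0 /\
      (transfer c d n *m dilation (c 0%N)) 1 0 = (transfer c' d' n *m dilation (c' 0%N)) 1 0.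
  by rewrite E.
elim: n hc hc' {E} => [|n IH] hc hc'.
  rewrite !mul1mx !mx2E => -[/polyC_inj/invr_inj E0 _].
  by split=> j; [rewrite leqn0 => /eqP-> | case: j].
have {}hcn j : (j <= n)%N -> 0 < c j by move=> jn; apply: hc; rewrite leqW.
have {}hcn' j : (j <= n)%N -> 0 < c' j by move=> jn; apply: hc'; rewrite leqW.
have deg e f : (forall j, (j <= n)%N -> 0 < e j) ->
    let W := transfer e f n *m dilation (e 0%N) in
    [/\ 0 < (W 0 0)`_n, (W 0 0)`_n.+1 = 0 & (W 1 0)`_n.+1 = 0 /\ (W 1 0)`_n = 0].
  move=> he; have [|lu su sv _ _] := @transfer_degree e f n.
    by move=> j /andP[_]; apply: he.
  rewrite /= (mx2_eta (transfer e f n)) mulmx2 !mx2E !mulr0 !addr0 !coefMC.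
  rewrite !(leq_sizeP _ _ sv) // (leq_sizeP _ _ su n.+1) // !mul0r.
  by rewrite mulr_gt0 ?invr_gt0 ?he.
have [lu u1 [v1 v0]] := deg c d hcn; have [lu' u1' [v1' v0']] := deg c' d' hcn'.
have {}IH := IH hcn hcn'; rewrite !transferS -!mulmxA; move: IH lu u1 v1 v0 lu' u1' v1' v0'.
move: (transfer c d n *m _) (transfer c' d' n *m _) => W W' IH lu u1 v1 v0 lu' u1' v1' v0'.
rewrite (mx2_eta W) (mx2_eta W') !mulmx2 !mx2E !mul0r !addr0 => -[E1 E2].
have p : 0 < c n.+1 by apply: hc.
have p' : 0 < c' n.+1 by apply: hc'.
(* With [L], [L'] the leading coefficients, the lower entries give [c n.+1 * L = c' n.+1 * L'] and
   the upper ones [c' n.+1 * L = c n.+1 * L']. Multiplied together they equate the squares, and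
   positivity removes the sign. *)
have Ec : c n.+1 = c' n.+1.
  have := congr1 (fun P : {poly R} => P`_n.+1) E1.
  have := congr1 (fun P : {poly R} => P`_n) E2.
  rewrite !coef_step !coefCM u1 u1' v1 v1' !mulr0 !subr0 !addr0.
  set L := (W 0 0)`_n in lu *; set L' := (W' 0 0)`_n in lu' *.
  rewrite !mulNr => /oppr_inj F1 F2.
  have F3 : c' n.+1 * L = c n.+1 * L'.
    have -> : L = c n.+1 * ((c n.+1)^-1 * L) by rewrite mulVKf // gt_eqF.
    by rewrite F2; field; rewrite gt_eqF.
  have : c n.+1 ^+ 2 * (L * L') = c' n.+1 ^+ 2 * (L * L').
    by transitivity ((c n.+1 * L) * (c n.+1 * L')); [ring | rewrite F1 -F3; ring].
  move/(mulIf (lt0r_neq0 (mulr_gt0 lu lu'))) => /eqP.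
  by rewrite eqrXn2 ?ltW // => /eqP.
have Eu : W 0 0 = W' 0 0.
  by move: E2; rewrite -Ec; apply: mulfI; rewrite polyC_eq0 oppr_eq0 gt_eqF.
have Es : ('X - (d n.+1)%:P) * W 0 0 + W 1 0 = ('X - (d' n.+1)%:P) * W 0 0 + W' 1 0.
  apply: (@mulfI _ (c n.+1)^-1%:P); first by rewrite polyC_eq0 invr_eq0 gt_eqF.
  by move: E1; rewrite -Ec -Eu !mulrDr !mulrA !mul_polyC.
have Ed : d n.+1 = d' n.+1.
  have := congr1 (fun P : {poly R} => P`_n) Es.
  rewrite !coefD !mulrBl !coefB !coefCM v0 v0' !addr0 => /addrI/oppr_inj.
  exact/mulIf/lt0r_neq0.
have [|IHc IHd] := IH.
  by split=> //; move: Es; rewrite -Ed => /addrI.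
split=> j.
  by rewrite leq_eqVlt => /orP[/eqP->|]; rewrite ?Ec // ltnS; apply: IHc.
move=> /andP[j1]; rewrite leq_eqVlt => /orP[/eqP->|]; rewrite ?Ed // ltnS => jn.
by apply: IHd; rewrite j1.
Qed.

(* By [transfer_flip], [X := transfer c d n *m flip (c 0)] satisfies
   [X *m V' = flip (c n)] with [V'] the transfer matrix of the reversed lists;
   since [\det X = -1], [\tr X = 0] means that [X] is an involution. *)
Lemma trace_transfer_flip c d n : (forall j, (j <= n)%N -> 0 < c j) ->
  \tr (transfer c d n *m flip (c 0%N)) = 0 <->
  (forall j, (j <= n)%N -> c j = c (n - j)%N) /\
  (forall j, (1 <= j <= n)%N -> d j = d (n - j).+1).
Proof.
move=> hc; have hc0 j : (j <= n)%N -> c j != 0 by move/hc/lt0r_neq0.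
have := @transfer_flip c d n hc0.
have detX : \det (transfer c d n *m flip (c 0%N)) = -1.
  rewrite det_mulmx det_transfer => [|j /andP[_ /hc0]] //.
  by rewrite detmx2 mul1r mulr0 sub0r -polyCM mulVf // hc0.
have := Cayley_Hamilton_mx2 (transfer c d n *m flip (c 0%N)).
rewrite detX raddfN opprK /=; set X := _ *m flip (c 0%N) => XX.
set V' := transfer _ _ _ => XV; split.
  move=> tr0; move: XX; rewrite tr0 scale0r add0r => XX.
  apply: (@transfer_dilation_inj c d (fun j => c (n - j)%N) (fun j => d (n - j).+1)) => //.
    by move=> j _; apply: hc; rewrite leq_subr.
  have -> : transfer (fun j => c (n - j)%N) (fun j => d (n - j).+1) n = X *m flip (c n).
    by rewrite -XV mulmxA XX mul1mx.
  suff E : flip (c 0%N) *m (flip (c n) *m dilation (c n)) = dilation (c 0%N).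
    by rewrite subn0 /X -!mulmxA E.
  rewrite !mulmx2 !mul0r !mulr0 !addr0 !add0r -!polyCM mulVf ?hc0 // mulfV ?hc0 //.
  by rewrite !mulr1 !mulr0 !polyC0.
move=> [pc pd]; have EV : V' = transfer c d n.
  by apply: eq_transfer => j jn; rewrite -?pc -?pd //; case/andP: jn.
have X1 : X *m X = 1%:M.
  rewrite {2}/X -EV mulmxA XV (pc 0%N) // subn0 flip_sq mulVf ?mulfV ?hc0 //.
  by rewrite mx2_1.
apply/eqP; apply: contraT => trX.
have trXX : \tr X *: X = 0 by apply: (addIr 1%:M); rewrite add0r -XX.
have /eqP : \det X = 0.
  apply: (mulfI (expf_neq0 2 trX)).
  by rewrite -detZ trXX det0 mulr0.
by rewrite detX oppr_eq0 oner_eq0.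
Qed.
End Transfer.

(* A rational fixed point would make the discriminant [(\tr Q) ^+ 2 - 4] a
   square [D ^+ 2], and then [\tr Q - D], [\tr Q + D] would be units. *)
Lemma fixed_point_irrational (F : numFieldType) (Q : 'M[{poly F}]_2) (E G : {poly F}) :
  \det Q = 1 -> (1 < size (\tr Q))%N ->
  Q 1 0 * G ^+ 2 - (Q 1 1 - Q 0 0) * E * G - Q 0 1 * E ^+ 2 = 0 ->
  E = 0 /\ G = 0.
Proof.
rewrite {1 2}(mx2_eta Q) detmx2 trmx2.
move: (Q 0 0) (Q 0 1) (Q 1 0) (Q 1 1) => q r s t det1 trQ H.
have s0 : s != 0.
  apply: contraTneq trQ => s0; move/eqP: det1; rewrite s0 mulr0 subr0 => /eqP det1.
  have : size (q * t) == 1%N by rewrite det1 size_poly1.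
  rewrite size_mul_eq1 -leqNgt => /andP[/eqP sq /eqP st].
  by rewrite (leq_trans (size_polyD _ _)) // sq st.
suff E0 : E = 0.
  split=> //; move: H; rewrite E0 mulr0 mul0r expr0n mulr0 !subr0 => /eqP.
  by rewrite mulf_eq0 (negbTE s0) expf_eq0 /= => /eqP.
apply/eqP; apply: contraLR trQ => E0; rewrite -leqNgt.
(* The hypothesis says that [- G / E] is a fixed point of [Q]; [U] comes from completing the square
   in it. *)
set U := 2%:R * s * G - (t - q) * E.
have HU : U ^+ 2 = ((q + t) ^+ 2 - 4%:R) * E ^+ 2.
  transitivity (((q + t) ^+ 2 - 4%:R * (q * t - r * s)) * E ^+ 2
    + 4%:R * s * (s * G ^+ 2 - (t - q) * E * G - r * E ^+ 2)); first by rewrite /U; ring.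
  by rewrite H det1 mulr0 addr0 mulr1.
have /dvdpP[D HD] : E %| U by rewrite -(@dvdp_pexp2r _ _ _ 2) // HU dvdp_mull.
have {}HD : D ^+ 2 = (q + t) ^+ 2 - 4%:R.
  by apply: (mulIf (expf_neq0 2 E0)); rewrite -HU HD exprMn.
have : size ((q + t - D) * (q + t + D)) == 1%N.
  rewrite -subr_sqr HD subKr -polyC_natr size_polyC.
  by rewrite pnatr_eq0.
rewrite size_mul_eq1 => /andP[/eqP s1 /eqP s2].
rewrite -(@size_scale _ 2%:R) ?pnatr_eq0 // (_ : _ *: _ = (q + t - D) + (q + t + D)).
  by rewrite (leq_trans (size_polyD _ _)) // s1 s2.
by rewrite scaler_nat; ring.
Qed.

(** * Truncated continued fractions in the upper half-plane *)

Section ContinuedFraction.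
Variable R : realType.
Local Notation C := R[i].
Implicit Types (a b : nat -> R) (z : C).

Lemma eq_cf_trunc a b a' b' n z :
  (forall j, (0 < j)%N -> a j = a' j) -> (forall j, (0 < j)%N -> b j = b' j) ->
  cf_trunc a b n z = cf_trunc a' b' n z.
Proof.
elim: n a b a' b' => //= n IH a b a' b' ha hb; rewrite ha // hb //.
by rewrite (IH _ _ (shift1 a') (shift1 b')) // => j j0; rewrite /shift1 ?ha ?hb.
Qed.

Lemma cvg_C_unique (u : nat -> C) x y : cvg_C u x -> cvg_C u y -> x = y.
Proof.
move=> ux uy; apply/eqP; apply: contraT => xy.
have e0 : 0 < `|x - y| / 2 by rewrite divr_gt0 // normr_gt0 subr_eq0.
have [M HM] := ux _ e0; have [N HN] := uy _ e0.
have := ltrD (HM (maxn M N) (leq_maxl _ _)) (HN (maxn M N) (leq_maxr _ _)).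
rewrite -splitr distrC => /(le_lt_trans (ler_distD _ _ _)).
by rewrite ltxx.
Qed.

Lemma real_complex_real (x : R) : x%:C \is Num.real.
Proof. by apply/complex_realP; exists x. Qed.

(** Keeps truncations in the closed upper half-plane and their denominators uniformly away from
    zero. The half-plane is closed because the empty truncation is [0]. *)
Lemma Im_cf_den (x y : R) z w : 0 < 'Im z -> 0 <= 'Im w ->
  'Im (x%:C - z - (y ^+ 2)%:C * w) <= - 'Im z.
Proof.
move=> z0 w0; rewrite !raddfB /= (Creal_ImP _ (real_complex_real _)) sub0r.
rewrite ImMl ?real_complex_real // gerBl mulr_ge0 // ler0c; exact: sqr_ge0.
Qed.

Lemma ler_Im_cf_den (x y : R) z w : 0 < 'Im z -> 0 <= 'Im w ->
  'Im z <= `|x%:C - z - (y ^+ 2)%:C * w|.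
Proof.
move=> z0 w0; have := Im_cf_den x y z0 w0; set D := _ - _ => HD.
rewrite -(@ler_pXn2r _ 2) ?nnegrE ?(ltW z0) // normC2_Re_Im.
have DN : 'Im z <= - 'Im D by rewrite lerNr.
apply: (@le_trans _ _ ('Im D ^+ 2)).
  by rewrite -[in leRHS]sqrrN ler_pXn2r ?nnegrE ?(le_trans (ltW z0)) // ltW.
by rewrite lerDr; apply: real_exprn_even_ge0 => //; apply: Creal_Re.
Qed.

Lemma Im_cf_trunc a b n z : 0 < 'Im z -> 0 <= 'Im (cf_trunc a b n z).
Proof.
move=> z0; elim: n a b => [|n IH] a b /=; first by rewrite raddf0.
rewrite div1r ImV mulr_ge0 ?invr_ge0 ?exprn_ge0 // oppr_ge0.
by rewrite (le_trans (Im_cf_den _ _ z0 (IH _ _))) // oppr_le0 ltW.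
Qed.

Lemma norm_cf_trunc a b n z : 0 < 'Im z -> `|cf_trunc a b n z| <= ('Im z)^-1.
Proof.
move=> z0; case: n => [|n] /=; first by rewrite normr0 invr_ge0 ltW.
have H := ler_Im_cf_den (b 1) (a 1) z0 (Im_cf_trunc (shift1 a) (shift1 b) n z0).
by rewrite div1r normfV lef_pV2 ?posrE // (lt_le_trans z0).
Qed.

(* The denominators of the truncations are bounded, so their limit [1 / m] is
   finite. *)
Lemma cf_tail a b z m : 0 < 'Im z -> a 1%N != 0 -> cvg_C (fun n => cf_trunc a b n z) m ->
  exists2 m', cvg_C (fun n => cf_trunc (shift1 a) (shift1 b) n z) m' &
    m * ((b 1%N)%:C - z - (a 1%N ^+ 2)%:C * m') = 1.
Proof.
move=> z0 a0 cm.
pose w n := cf_trunc (shift1 a) (shift1 b) n z.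
pose D n := (b 1%N)%:C - z - (a 1%N ^+ 2)%:C * w n.
have D0 n : 0 < `|D n|.
  exact: lt_le_trans z0 (ler_Im_cf_den _ _ z0 (Im_cf_trunc _ _ _ z0)).
pose B := `|(b 1%N)%:C - z| + `|(a 1%N ^+ 2)%:C| * ('Im z)^-1.
have DB n : `|D n| <= B.
  rewrite (le_trans (ler_normB _ _)) // lerD2l normrM ler_wpM2l //.
  exact: norm_cf_trunc.
have B0 : 0 < B by apply: lt_le_trans (D0 0%N) (DB 0%N).
have m0 : m != 0.
  apply/eqP => m0; have [|N HN] := cm B^-1; first by rewrite invr_gt0.
  have := HN N.+1 (leqnSn _); rewrite m0 subr0 /= div1r normfV.
  by rewrite -/(w N) -/(D N) ltf_pV2 ?posrE // => /lt_le_trans/(_ (DB N)); rewrite ltxx.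
have a20 : (a 1%N ^+ 2)%:C != 0 :> C by rewrite fmorph_eq0 expf_neq0.
exists (((b 1%N)%:C - z - m^-1) / (a 1%N ^+ 2)%:C); last first.
  by rewrite mulrCA mulfV // mulr1 subKr mulfV.
move=> e e0.
(* The tolerance comes from [w n - m' = (1 / D n - m) * (D n / m) / a_1^2], where [m'] is the
   witness and [D n] is bounded by [B]. *)
have [|N HN] := cm (e * `|(a 1%N ^+ 2)%:C| * (`|m| / B)).
  by rewrite !mulr_gt0 ?normr_gt0 ?invr_gt0.
exists N => n /leqW/HN /=; rewrite div1r -/(w n) -/(D n) => H.
have -> : w n - ((b 1%N)%:C - z - m^-1) / (a 1%N ^+ 2)%:C =
    ((D n)^-1 - m) * (D n / m) / (a 1%N ^+ 2)%:C.
  have D0' : D n != 0 by rewrite -normr_gt0.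
  have -> : w n = ((b 1%N)%:C - z - D n) / (a 1%N ^+ 2)%:C.
    by rewrite /D subKr mulrC mulKf.
  rewrite -mulrBl; congr (_ / _); by field; rewrite m0 D0'.
rewrite !normrM !normfV ltr_pdivrMr ?normr_gt0 //.
have : `|(D n)^-1 - m| * (`|D n| / `|m|) <= `|(D n)^-1 - m| * (B / `|m|).
  by rewrite ler_wpM2l // ler_wpM2r ?invr_ge0.
move/le_lt_trans; apply.
by rewrite -ltr_pdivlMr ?divr_gt0 ?normr_gt0 // invf_div.
Qed.
End ContinuedFraction.

(** * Evaluation at a point and the action on m-functions *)

Section Evaluation.
Variable R : realType.
Local Notation C := R[i].
Implicit Types (a b : nat -> R) (z m : C).

Definition pev z : {rmorphism {poly R} -> C} := horner_eval z \o map_poly (real_complex R).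

Lemma pev_polyC z (x : R) : pev z x%:P = x%:C.
Proof. by rewrite /= map_polyC /= /horner_eval hornerC. Qed.

Lemma pevX z : pev z 'X = z.
Proof. by rewrite /= map_polyX /horner_eval hornerX. Qed.

Lemma pev_step z (x y : R) :
  map_mx (pev z) (step x y) = mx2 ((z - y%:C) / x%:C) (x%:C)^-1 (- x%:C) 0.
Proof.
rewrite map_mx2 -mul_polyC rmorphM rmorphB rmorph0 !pev_polyC pevX.
by rewrite fmorphV rmorphN mulrC.
Qed.

Lemma pev_eq0 (P : {poly R}) : (forall z, 0 < 'Im z -> pev z P = 0) -> P = 0.
Proof.
move=> HP; apply: (@map_poly_inj _ _ (real_complex R)); rewrite rmorph0.
set F := map_poly _ P; apply/eqP; apply: contraT => F0.
pose rs := [seq n%:R + 'i : C | n <- iota 0 (size F)].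
have := @max_poly_roots _ F rs F0; rewrite size_map size_iota ltnn; apply.
  apply/allP => _ /mapP[n _ ->]; apply/eqP; apply: HP.
  by rewrite raddfD /= Im_i (Creal_ImP _ (realn _ _)) add0r ltr01.
rewrite map_inj_uniq ?iota_uniq // => i j /addIr/eqP.
by rewrite eqr_nat => /eqP.
Qed.

(** The three-term recurrence in matrix form. The length is a successor because [n.-1] is [0] at
    [n = 0], where [p_0] would stand in for [p_(-1)]. *)
Lemma Tmat_transfer a b n z :
  Tmat a b n.+1 (a n.+1) z = map_mx (pev z) (transfer a b n.+1).
Proof.
have -> : Tmat a b n.+1 (a n.+1) z =
    mx2 (opoly a b n.+1 z) (Defs.qpoly a b n.+1 z)
        (- (a n.+1)%:C * opoly a b n z) (- (a n.+1)%:C * Defs.qpoly a b n z).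
  by rewrite [LHS]mx2_eta !mxE.
elim: n => [|n IH].
  rewrite transferS [transfer _ _ 0]/= mulmx1 pev_step /opoly /=.
  by congr mx2; rewrite ?mulr0 ?subr0 ?mulr1.
rewrite transferS map_mxM pev_step -IH mulmx2 !mul0r !addr0.
(* The second component of the pair is [p_(n-1)] of the shifted list with [p_(-1) = 0], in agreement
   with [q_0 = 0]. *)
have q2 : (Defs.qpoly a b n z) =
    (a 1%N)%:C^-1 * (opoly_pair (shift1 a) (shift1 b) n z).2.
  by case: n {IH} => [|n] /=; rewrite ?mulr0 // /opoly; case: (opoly_pair _ _ n z).
congr mx2.
- rewrite {1}/opoly /=; rewrite /opoly /=; case: (opoly_pair a b n z) => u v /=.
  by ring.
- rewrite q2 /= /opoly /=; case: (opoly_pair _ _ n z) => u v /=.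
  by rewrite /shift1; ring.
Qed.

(** Homogeneous coordinates, in which Moebius maps compose up to scalars without dividing. *)
Definition homog m : 'cV[C]_2 := \col_i (if i == 0 then m else 1).

Lemma mul_homog (X : 'M[C]_2) m :
  ((X *m homog m) 0 0 = X 0 0 * m + X 0 1) * ((X *m homog m) 1 0 = X 1 0 * m + X 1 1).
Proof.
by split; rewrite mxE big_ord_recl big_ord1 /= !mxE /= mulr1;
  congr (_ + X _ _); apply/val_inj.
Qed.

(** This is [m = 1 / (y - z - x^2 m')] solved for [m']; the factor [- x m] is the Moebius
    denominator. *)
Lemma step_homog (x y : R) z m m' : x != 0 ->
  m * (y%:C - z - (x ^+ 2)%:C * m') = 1 ->
  map_mx (pev z) (step x y) *m homog m = (- x%:C * m) *: homog m'.
Proof.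
move=> x0 H; have x0' : x%:C != 0 :> C by rewrite fmorph_eq0.
have H' : (z - y%:C) * m + 1 = - (x ^+ 2)%:C * m * m' by rewrite -H; ring.
apply/matrixP => i j; rewrite ord1 pev_step {j} [RHS]mxE mxE big_ord_recl big_ord1 !mxE /=.
case: i => -[|[|//]] ? /=; last by rewrite !mulr1 addr0.
apply: (mulfI x0'); rewrite mulr1 mulrDr mulfV // mulrA mulrCA mulfV // mulr1.
by rewrite H' rmorphXn /=; ring.
Qed.

Lemma cf_tail_iter a b z m n : 0 < 'Im z -> (forall j, (1 <= j <= n)%N -> a j != 0) ->
  cvg_C (fun i => cf_trunc a b i z) m ->
  exists m', cvg_C (fun i => cf_trunc (fun j => a (j + n)%N) (fun j => b (j + n)%N) i z) m' /\
    exists x, map_mx (pev z) (transfer a b n) *m homog m = x *: homog m'.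
Proof.
move=> z0; elim: n => [|n IH] ha cm.
  exists m; split; last by exists 1; rewrite map_mx1 mul1mx scale1r.
  by move=> e /cm[N HN]; exists N => i /HN; rewrite (@eq_cf_trunc _ _ _ a b) // => j; rewrite addn0.
have [|m' [cm' [x Hx]]] := IH _ cm.
  by move=> j /andP[j1 jn]; apply: ha; rewrite j1 leqW.
have a0 : a (1 + n)%N != 0 by rewrite ha // ltnSn.
have [m'' cm'' H] := cf_tail z0 a0 cm'.
exists m''; split.
  move=> e /cm''[N HN]; exists N => i /HN.
  set f := cf_trunc _ _ _ _; set g := cf_trunc _ _ _ _.
  by have -> : f = g by apply: eq_cf_trunc => j _; rewrite /shift1 addSnnS.
exists (x * (- (a n.+1)%:C * m')).
by rewrite transferS map_mxM -mulmxA Hx -scalemxAr (step_homog a0 H) scalerA.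
Qed.

Lemma homog_fixed (Q : 'M[{poly R}]_2) z m y :
  map_mx (pev z) Q *m homog m = y *: homog m ->
  pev z (Q 1 0) * m ^+ 2 + pev z (Q 1 1 - Q 0 0) * m - pev z (Q 0 1) = 0.
Proof.
move=> HQ; have [] := mul_homog (map_mx (pev z) Q) m.
rewrite HQ !mxE /= mulr1 => E0 E1; rewrite rmorphB.
transitivity ((pev z (Q 1 0) * m + pev z (Q 1 1)) * m -
  (pev z (Q 0 0) * m + pev z (Q 0 1))); first by ring.
by rewrite -E0 -E1 subrr.
Qed.
End Evaluation.

(** * Palindromic words as reflections of periodic sequences *)

Section Words.
Variable R : realType.
Implicit Types (a b : nat -> R) (p l n : nat).

Lemma palindrome_mkseqP (f : nat -> R) n :
  reflect (forall i, (i < n)%N -> f i = f (n - i.+1)%N) (palindrome (mkseq f n)).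
Proof.
apply: (iffP eqP) => [E i lin | E].
  have := congr1 (fun s => nth 0 s i) E.
  by rewrite nth_rev ?size_mkseq // !nth_mkseq //; lia.
apply: (@eq_from_nth _ 0); rewrite ?size_rev // size_mkseq => i lin.
by rewrite nth_rev ?size_mkseq // !nth_mkseq //; [exact: E | lia].
Qed.

Lemma take_word p a n : (n <= p)%N -> take n (word p a) = mkseq (fun i => a i.+1) n.
Proof. by move=> np; rewrite /word /mkseq -map_take take_iota (minn_idPl np). Qed.

Lemma drop_word p a n :
  drop n (word p a) = mkseq (fun i => a (n + i).+1) (p - n).
Proof.
rewrite /word /mkseq -map_drop drop_iota add0n -[n in iota n]addn0 iotaDl -map_comp.
by apply: eq_map.
Qed.

(** Adding [p] before the predecessor makes index [0] yield [a p], the value preceding [a 1] in the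
    periodic sequence. *)
Definition periodize p a : nat -> R := fun j => a ((j + p).-1 %% p).+1.

Lemma periodizeE p a j : (0 < j <= p)%N -> periodize p a j = a j.
Proof.
case: j => // j /= jp; rewrite /periodize addSn /= modnDr modn_small //.
Qed.

Lemma periodize0 p a : (0 < p)%N -> periodize p a 0%N = a p.
Proof. by case: p => // p _; rewrite /periodize /= modn_small. Qed.

Lemma periodizeD p a j : (0 < p)%N -> periodize p a (j + p)%N = periodize p a j.
Proof.
by case: p => // p _; rewrite /periodize !addnS /= addSnnS modnDr.
Qed.

Lemma doubly_palindromicP p l a b : (l.+1 < p)%N ->
  doubly_palindromic p l a b <->
  [/\ forall i, (0 < i <= l)%N -> a i = a (l.+1 - i)%N,
      forall i, (l < i <= p)%N -> a i = a (p + l.+1 - i)%N,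
      forall i, (0 < i <= l.+1)%N -> b i = b (l.+2 - i)%N &
      forall i, (l.+1 < i <= p)%N -> b i = b (p + l.+2 - i)%N].
Proof.
move=> lp; rewrite /doubly_palindromic !take_word ?drop_word; [|lia..].
split.
  case/and4P => /palindrome_mkseqP H1 /palindrome_mkseqP H2
    /palindrome_mkseqP H3 /palindrome_mkseqP H4; split=> i il.
  - have -> : i = i.-1.+1 by lia.
    by rewrite H1; [congr a; lia | lia].
  - have -> : i = (l + (i - l.+1)).+1 by lia.
    by rewrite H2; [congr a; lia | lia].
  - have -> : i = i.-1.+1 by lia.
    by rewrite H3; [congr b; lia | lia].
  - have -> : i = (l.+1 + (i - l.+2)).+1 by lia.
    by rewrite H4; [congr b; lia | lia].
case=> H1 H2 H3 H4; apply/and4P; split; apply/palindrome_mkseqP => i il.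
- by rewrite H1; [congr a; lia | lia].
- by rewrite H2; [congr a; lia | lia].
- by rewrite H3; [congr b; lia | lia].
- by rewrite H4; [congr b; lia | lia].
Qed.

(* Reflecting [1 .. l + 1] and [1 .. l + 1 + p] about their centres both
   realize the same reflection of the periodic sequences. *)
Lemma doubly_palindromic_periodize p l a b : (l.+1 < p)%N ->
  let c := periodize p a in let d := periodize p b in
  let sym n := (forall j, (j <= n)%N -> c j = c (n - j)%N) /\
               (forall j, (1 <= j <= n)%N -> d j = d (n - j).+1) in
  doubly_palindromic p l a b <-> sym l.+1 /\ sym (l.+1 + p)%N.
Proof.
move=> lp c d sym; rewrite doubly_palindromicP //.
have p0 : (0 < p)%N by lia.
have cE j : (0 < j <= p)%N -> c j = a j by exact: periodizeE.
have dE j : (0 < j <= p)%N -> d j = b j by exact: periodizeE.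
have c0 : c 0%N = a p by exact: periodize0.
have cD j : c (j + p)%N = c j by exact: periodizeD.
have dD j : d (j + p)%N = d j by exact: periodizeD.
split; last first.
  case=> _ [H1 H2]; split=> i il.
  - rewrite -!cE; [|lia..]; rewrite H1; last lia.
    by rewrite -[RHS]cD; congr c; lia.
  - by rewrite -!cE; [|lia..]; rewrite H1; [congr c; lia | lia].
  - rewrite -!dE; [|lia..]; rewrite H2; last lia.
    by rewrite -[RHS]dD; congr d; lia.
  - by rewrite -!dE; [|lia..]; rewrite H2; [congr d; lia | lia].
case=> H1 H2 H3 H4.
have short : sym l.+1.
  split=> j jl.
    (* The indices [0] and [l.+1] are exchanged, and [c 0 = a p] equals [a l.+1] by the ends of the
       second palindrome. *)
    case: (posnP j) => [->|j0].
      by rewrite subn0 c0 cE; [rewrite H2; [congr a; lia | lia] | lia].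
    case: (ltngtP j l.+1) => [jl'|jl'|->]; [|lia|].
      by rewrite !cE; [rewrite H1; [congr a; lia | lia] | lia..].
    by rewrite subnn c0 cE; [rewrite H2; [congr a; lia | lia] | lia].
  by rewrite !dE; [rewrite H3; [congr b; lia | lia] | lia..].
split=> //; have [S1 S2] := short.
split=> j jl.
  case: (leqP j l) => [jl'|lj].
    by rewrite S1; [rewrite -[LHS]cD; congr c; lia | lia].
  case: (leqP j p) => [jp|pj].
    by rewrite !cE; [rewrite H2; [congr a; lia | lia] | lia..].
  have -> : j = (j - p + p)%N by lia.
  by rewrite cD S1; [congr c; lia | lia].
case: (leqP j l.+1) => [jl'|lj].
  by rewrite S2; [rewrite -[LHS]dD; congr d; lia | lia].
case: (leqP j p) => [jp|pj].
  by rewrite !dE; [rewrite H4; [congr b; lia | lia] | lia..].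
have -> : j = (j - p + p)%N by lia.
by rewrite dD S2; [congr d; lia | lia].
Qed.

(** The product in the second trace is the transfer matrix of the first [l.+1 + p] periodic
    coefficients, so the two traces express the two reflections. *)
Lemma doubly_palindromic_trace p l a b : (l.+1 < p)%N ->
  (forall j, (1 <= j <= p)%N -> 0 < a j) ->
  doubly_palindromic p l a b <->
  \tr (flip (a p) *m transfer a b l.+1) = 0 /\
  \tr (flip (a p) *m (transfer a b l.+1 *m transfer a b p)) = 0.
Proof.
move=> lp a0; rewrite doubly_palindromic_periodize //.
have p0 : (0 < p)%N by lia.
set c := periodize p a; set d := periodize p b.
have c0 j : 0 < c j by apply: a0; rewrite /= ltn_mod.
have cp : flip (a p) = flip (c 0%N) by rewrite /c periodize0.
have E n : (n <= p)%N -> transfer a b n = transfer c d n.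
  by move=> np; apply: eq_transfer => j jn; rewrite /c /d periodizeE //; lia.
have -> : transfer a b l.+1 *m transfer a b p = transfer c d (l.+1 + p).
  rewrite transfer_add !E //; last lia.
  by congr (_ *m _); apply: eq_transfer => j _; rewrite /c /d periodizeD.
rewrite E; last lia.
rewrite cp ![\tr (flip _ *m _)]mxtrace_mulC !trace_transfer_flip //.
Qed.
End Words.

(** * The Moebius identity as a pair of trace conditions *)

(** With denominators cleared, the identity is a linear relation in [M]; as [M] is irrational, both
    coefficients vanish. The excluded points are zeros of one nonzero polynomial, and multiplying by
    it extends the relation to the whole half-plane. *)
Lemma second_solution_mobius (R : realType) (M : R[i] -> R[i]) (A B C : {poly R})
    (Q T : 'M[{poly R}]_2) (x : R) :
  \det Q = 1 -> (1 < size (\tr Q))%N -> \det T = 1 -> x != 0 -> A != 0 ->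
  (forall z, 0 < 'Im z ->
     pev z (Q 1 0) * M z ^+ 2 + pev z (Q 1 1 - Q 0 0) * M z - pev z (Q 0 1) = 0) ->
  (forall z, 0 < 'Im z -> pev z A * M z ^+ 2 + pev z B * M z + pev z C = 0) ->
  let Mt z := - pev z B / pev z A - M z in
  (forall z, 0 < 'Im z -> pev z A != 0 -> Mt z != 0 ->
     mobius_den (map_mx (pev z) T) (M z) != 0 ->
     1 / ((x ^+ 2)%:C * Mt z) = mobius (map_mx (pev z) T) (M z)) <->
  \tr (flip x *m T) = 0 /\ \tr (flip x *m (T *m Q)) = 0.
Proof.
move=> detQ trQ detT x0 A0 MQ MA Mt.
have irrM E F : (forall z, 0 < 'Im z -> pev z E * M z + pev z F = 0) -> E = 0 /\ F = 0.
  move=> HM; apply: (fixed_point_irrational detQ trQ); apply: pev_eq0 => z z0.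
  have HF : pev z F = - (pev z E * M z) by apply/eqP; rewrite -addr_eq0 addrC HM.
  rewrite !(rmorphXn, rmorphM, rmorphB) HF.
  have := congr1 (fun u => pev z E ^+ 2 * u) (MQ z z0); rewrite mulr0 rmorphB => <-.
  by ring.
(* Eliminating [M^2] between the two quadratics shows that [(A, B, C)] is proportional to
   [(Q 1 0, Q 1 1 - Q 0 0, - Q 0 1)], so the second solution is the other fixed point of [Q]. *)
have [AB /eqP AC] : A * (Q 1 1 - Q 0 0) - Q 1 0 * B = 0 /\ - (A * Q 0 1) - Q 1 0 * C = 0.
  apply: irrM => z z0.
  transitivity (pev z A * (pev z (Q 1 0) * M z ^+ 2 + pev z (Q 1 1 - Q 0 0) * M z - pev z (Q 0 1))
     - pev z (Q 1 0) * (pev z A * M z ^+ 2 + pev z B * M z + pev z C)).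
    by rewrite !(rmorphN, rmorphM, rmorphB); ring.
  by rewrite MQ // MA // !mulr0 subrr.
have {}AB : Q 1 0 * B = A * (Q 1 1 - Q 0 0) by apply/eqP; rewrite eq_sym -subr_eq0 AB.
have {}AC : Q 1 0 * C = - (A * Q 0 1) by apply/eqP; rewrite eq_sym -subr_eq0 AC.
have irrA E F : A * F ^+ 2 - B * E * F + C * E ^+ 2 = 0 -> E = 0 /\ F = 0.
  move=> H; apply: (fixed_point_irrational detQ trQ); apply: (mulfI A0).
  rewrite mulr0 -[RHS](mulr0 (Q 1 0)) -H.
  transitivity (A * Q 1 0 * F ^+ 2 - Q 1 0 * B * E * F + Q 1 0 * C * E ^+ 2).
    by rewrite AB AC; ring.
  by ring.
(* [A * X1] and [X2] are the coefficients of [M] and [1] once the cleared identity is multiplied by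
   [A] and reduced by the quadratic. *)
pose X1 := T 1 0 + (x ^+ 2)%:P * T 0 1.
pose X2 := A * T 1 1 - (x ^+ 2)%:P * (T 0 0 * C - T 0 1 * B).
have traces : \tr (flip x *m T) = 0 /\ \tr (flip x *m (T *m Q)) = 0 <-> X1 = 0 /\ X2 = 0.
  have xP : x%:P != 0 by rewrite polyC_eq0.
  have xV : x%:P * x^-1%:P = 1 by rewrite -polyCM mulfV.
  have t1 : x%:P * \tr (flip x *m T) = X1.
    rewrite (mx2_eta T) mulmx2 trmx2 /X1 !mul0r add0r addr0 mulrDr !mulrA xV mul1r.
    by rewrite -polyCM.
  have t2 : A * (x%:P * \tr (flip x *m (T *m Q))) = Q 1 0 * X2 + A * (Q 0 0 * X1).
    rewrite {1}(mx2_eta T) {1}(mx2_eta Q) !mulmx2 trmx2 !mul0r add0r addr0.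
    rewrite mulrDr !mulrA xV mul1r -!mulrA [x%:P * (x%:P * _)]mulrA -polyCM -expr2.
    transitivity (A * T 1 1 * Q 1 0 - (x ^+ 2)%:P * (T 0 0 * (Q 1 0 * C) - T 0 1 * (Q 1 0 * B))
                  + A * (Q 0 0 * X1)); last by rewrite /X2; ring.
    by rewrite AB AC /X1; ring.
  have Q10 : Q 1 0 != 0.
    apply/eqP => Q10; have [] := @fixed_point_irrational _ Q 0 1 detQ trQ.
      by rewrite Q10; ring.
    by move=> _ /eqP; rewrite oner_eq0.
  split=> [[h1 h2]|[h1 h2]].
    have X10 : X1 = 0 by rewrite -t1 h1 mulr0.
    split=> //; apply: (mulfI Q10); move: t2.
    by rewrite h2 X10 !mulr0 addr0.
  split; first by apply: (mulfI xP); rewrite t1 h1 mulr0.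
  by apply: (mulfI A0); apply: (mulfI xP); rewrite [LHS]mulrCA t2 h1 h2 !mulr0 addr0.
rewrite traces {traces}.
have equation z : 0 < 'Im z -> pev z A != 0 -> Mt z != 0 ->
    mobius_den (map_mx (pev z) T) (M z) != 0 ->
    1 / ((x ^+ 2)%:C * Mt z) = mobius (map_mx (pev z) T) (M z) <->
    pev z (A * X1) * M z + pev z X2 = 0.
  move=> z0 Az Mtz; rewrite /mobius_den /mobius !mxE => den.
  have x2 : (x ^+ 2)%:C != 0 :> R[i] by rewrite fmorph_eq0 expf_neq0.
  have AMt : pev z A * Mt z = - pev z B - pev z A * M z.
    by rewrite /Mt mulrBr mulrCA mulfV // mulr1.
  have E : pev z (A * X1) * M z + pev z X2 = pev z A *
      (pev z (T 1 0) * M z + pev z (T 1 1) -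
       (x ^+ 2)%:C * Mt z * (pev z (T 0 0) * M z + pev z (T 0 1))).
    transitivity (pev z A * (pev z (T 1 0) * M z + pev z (T 1 1)) -
       (x ^+ 2)%:C * (pev z A * Mt z) * (pev z (T 0 0) * M z + pev z (T 0 1)));
      last by ring.
    rewrite AMt /X1 /X2; move: (x ^+ 2) => y.
    rewrite !(rmorphM, rmorphD, rmorphN) !pev_polyC.
    have HC : pev z C = - (pev z A * M z ^+ 2 + pev z B * M z).
      by apply/eqP; rewrite -addr_eq0 addrC MA.
    by rewrite HC; ring.
  rewrite E; split=> [H | /eqP].
    apply/eqP; rewrite mulf_eq0 subr_eq0; apply/orP; right.
    move/eqP: H; rewrite eqr_div ?mulf_neq0 // mul1r => /eqP ->.
    by rewrite mulrC.
  rewrite mulf_eq0 (negbTE Az) subr_eq0 /= => /eqP H.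
  by apply/eqP; rewrite eqr_div ?mulf_neq0 // mul1r H mulrC.
split; last first.
  move=> [X10 X20] z z0 Az Mtz den; apply/equation => //.
  by rewrite X10 X20 mulr0 !rmorph0 mul0r addr0.
move=> H.
have C0 : C != 0.
  apply/eqP => C0; have [|/eqP] := irrA 1 0; first by rewrite C0; ring.
  by rewrite oner_eq0.
(* The quadratic at [- T 1 1 / T 1 0], cleared of fractions: it vanishes wherever the Moebius
   denominator does, as [C] vanishes wherever the second solution does. *)
pose D := A * T 1 1 ^+ 2 - B * T 1 0 * T 1 1 + C * T 1 0 ^+ 2.
have D0 : D != 0.
  apply/eqP => /irrA[T10 T11]; move: detT; rewrite (mx2_eta T) detmx2 T10 T11.
  by rewrite !mulr0 subrr => /eqP; rewrite eq_sym oner_eq0.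
have ACD : A * C * D != 0 by rewrite !mulf_neq0.
have [] := irrM (A * C * D * (A * X1)) (A * C * D * X2).
  move=> z z0; rewrite [pev z (_ * (A * X1))]rmorphM [pev z (_ * X2)]rmorphM -mulrA -mulrDr.
  have [-> | ] := eqVneq (pev z (A * C * D)) 0; first by rewrite mul0r.
  rewrite !rmorphM !mulf_eq0 !negb_or => /andP[/andP[Az Cz] Dz].
  have Mtz : Mt z != 0.
    apply: contraNneq Cz => Mt0.
    have BM : pev z A * M z + pev z B = 0.
      have := congr1 (fun u => - (pev z A * u)) Mt0.
      rewrite /Mt mulr0 oppr0 mulrBr mulrCA mulfV // mulr1 opprB => <-.
      by ring.
    by rewrite -(MA z z0) expr2 mulrA -mulrDl BM mul0r add0r.
  have den : mobius_den (map_mx (pev z) T) (M z) != 0.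
    rewrite /mobius_den !mxE; apply: contraNneq Dz => den0.
    have T11 : pev z (T 1 1) = - (pev z (T 1 0) * M z).
      by apply/eqP; rewrite -addr_eq0 addrC den0.
    rewrite !(rmorphXn, rmorphM, rmorphD, rmorphN) T11.
    apply/eqP; transitivity (pev z (T 1 0) ^+ 2 * (pev z A * M z ^+ 2 + pev z B * M z + pev z C)).
      by ring.
    by rewrite MA // mulr0.
  have := H z z0 Az Mtz den; rewrite equation // rmorphM => ->.
  by rewrite mulr0.
move=> E1 E2; split; last by apply: (mulfI ACD); rewrite E2 mulr0.
by apply: (mulfI A0); apply: (mulfI ACD); rewrite E1 !mulr0.
Qed.

(** * Assembly for the eventually periodic m-function *)

Theorem theorem1p2 (R : realType) (k p l : nat) (al be a b : nat -> R)
    (M : R[i] -> R[i]) (A B C : {poly R}) :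
  (1 <= k)%N ->
  (1 <= l)%N -> (l <= p - 2)%N ->
  (forall j, (1 <= j <= k)%N -> 0 < al j) ->
  (forall j, (1 <= j <= p)%N -> 0 < a j) ->
  al k = a p -> be k = b p ->
  is_m_function_of (evper k p al a) (evper k p be b) M ->
  A != 0 ->
  (forall z : R[i], 0 < 'Im z ->
     pevalC A z * M z ^+ 2 + pevalC B z * M z + pevalC C z = 0) ->
  let Mt := fun z : R[i] => - pevalC B z / pevalC A z - M z in
  let al0 := fun j : nat => if j == 0%N then al k else al j in
  let al3 := fun j : nat => al0 (k - j)%N in
  let be3 := fun j : nat => be (k - j).+1 in
  let T := fun z : R[i] =>
    Tmat al3 be3 k (al k) z *m Tmat a b l.+1 (a l.+1) z *m Tmat al be k (al k) z in
  doubly_palindromic p l a b <->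
  (forall z : R[i], 0 < 'Im z -> pevalC A z != 0 -> Mt z != 0 ->
     mobius_den (T z) (M z) != 0 ->
     1 / ((al k ^+ 2)%:C * Mt z) = mobius (T z) (M z)).
Proof.
move=> k1 l1 lp al_gt0 a_gt0 alk bek cM A0 MA Mt al0 al3 be3 T.
have lp' : (l.+1 < p)%N by lia.
have al_neq0 j : (1 <= j <= k)%N -> al j != 0 by move/al_gt0/lt0r_neq0.
have a_neq0 j : (1 <= j <= p)%N -> a j != 0 by move/a_gt0/lt0r_neq0.
have alk0 : al k != 0 by rewrite al_neq0 // k1 /=.
have al0_neq0 j : (j <= k)%N -> al0 j != 0.
  by rewrite /al0; case: (j =P 0%N) => // j0 jk; rewrite al_neq0 //; lia.
pose T1 := transfer al be k; pose T2 := transfer a b l.+1.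
pose T3 := transfer al3 be3 k; pose P := transfer a b p.
have detT1 : \det T1 = 1 by exact: det_transfer.
have detT2 : \det T2 = 1.
  by apply: det_transfer => j jl; apply: a_neq0; lia.
have detT3 : \det T3 = 1.
  by apply: det_transfer => j _; apply: al0_neq0; rewrite leq_subr.
have detP : \det P = 1 by exact: det_transfer.
(* [T1] sends [M] to its purely periodic tail, which [P] fixes, so [Q] fixes [M]. The adjugate is
   the inverse since [\det T1 = 1]. *)
pose Q := \adj T1 *m P *m T1.
have detadj : \det (\adj T1) = 1.
  by have := congr1 determinant (mul_adj_mx T1); rewrite detT1 det1 det_mulmx detT1 mulr1.
have detQ : \det Q = 1 by rewrite !det_mulmx detadj detP detT1 !mulr1.
have trQ : (1 < size (\tr Q))%N.
  rewrite mxtrace_mulC mulmxA mul_mx_adj detT1 mul1mx.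
  by apply: size_trace_transfer => //; lia.
have TE z : T z = map_mx (pev z) (T3 *m T2 *m T1).
  have Tmat_k u v : Tmat u v k (u k) z = map_mx (pev z) (transfer u v k).
    by rewrite -(prednK k1) Tmat_transfer.
  rewrite map_mxM (map_mxM _ T3) -!Tmat_k -[map_mx _ T2]Tmat_transfer.
  by rewrite /T /al3 subnn.
have MQ z : 0 < 'Im z ->
    pev z (Q 1 0) * M z ^+ 2 + pev z (Q 1 1 - Q 0 0) * M z - pev z (Q 0 1) = 0.
  move=> z0; set e := evper k p al a; set f := evper k p be b.
  have [|N [cN [x]]] := @cf_tail_iter _ e f z (M z) k z0 _ (cM z z0).
    by move=> j jk; have /andP[_ jk'] := jk; rewrite /e /evper jk' al_neq0.
  have evE u v j : (0 < j <= p)%N -> evper k p u v (j + k) = v j.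
    move=> jp; rewrite /evper ifN; last lia.
    by rewrite addnK modn_small; [congr v; lia | lia].
  have -> : transfer e f k = T1.
    by apply: eq_transfer => j /andP[_ jk]; rewrite /e /f /evper jk.
  move=> HN.
  have [|N' [cN' [y]]] := @cf_tail_iter _ _ _ z N p z0 _ cN.
    by move=> j jp; rewrite /e evE // a_neq0.
  have -> : transfer (fun j => e (j + k)%N) (fun j => f (j + k)%N) p = P.
    by apply: eq_transfer => j jp; rewrite /e /f evE.
  have -> : N' = N.
    apply: cvg_C_unique cN' _ => eps /cN[n Hn]; exists n => i /Hn.
    have ev u v j : (0 < j)%N -> evper k p u v (j + p + k) = evper k p u v (j + k).
      move=> j0; rewrite /evper !ifN; [|lia..].
      by congr (v _.+1); rewrite !addnK -(modnDr j.-1); congr (_ %% _)%N; lia.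
    by rewrite (@eq_cf_trunc _ (fun j => e (j + p + k)%N) (fun j => f (j + p + k)%N)
      (fun j => e (j + k)%N) (fun j => f (j + k)%N)) // => j j0; apply: ev.
  move=> HP.
  apply: (@homog_fixed _ _ _ _ y).
  rewrite /Q !map_mxM -mulmxA HN -scalemxAr -mulmxA HP -!scalemxAr scalerA mulrC.
  rewrite -scalerA [x *: _]scalemxAr -HN mulmxA -map_mxM mul_adj_mx detT1.
  by rewrite map_mx1 mul1mx.
rewrite doubly_palindromic_trace // -/T2 -/P.
have -> : (forall z : R[i], 0 < 'Im z -> pevalC A z != 0 -> Mt z != 0 ->
     mobius_den (T z) (M z) != 0 ->
     1 / ((al k ^+ 2)%:C * Mt z) = mobius (T z) (M z)) <->
   \tr (flip (al k) *m (T3 *m T2 *m T1)) = 0 /\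
   \tr (flip (al k) *m (T3 *m T2 *m T1 *m Q)) = 0.
  rewrite -(second_solution_mobius detQ trQ _ alk0 A0 MQ MA); last first.
    by rewrite det_mulmx (det_mulmx T3) detT1 detT2 detT3 !mulr1.
  by split=> H z z0 Az Mz; [have := H z z0 Az Mz; rewrite TE | rewrite TE; apply: H].
(* [T3] belongs to the reversed list of [T1], and [al0 0 = al k] makes the flips on both sides
   equal. *)
have T1K : T1 *m flip (al k) *m T3 = flip (al k).
  have al0E j : (0 < j)%N -> al0 j = al j by move=> j0; rewrite /al0 gtn_eqF.
  have := @transfer_flip _ al0 be k al0_neq0.
  rewrite (al0E k) // (@eq_transfer _ al0 be al be) // => j /andP[j0 _]; exact: al0E.
clearbody T1 T2 T3 P.
have -> : T3 *m T2 *m T1 *m Q = T3 *m T2 *m P *m T1.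
  by rewrite /Q !mulmxA -(mulmxA (T3 *m T2) T1) mul_mx_adj detT1 mulmx1.
(* The trace is cyclic, so [T1K] absorbs the outer factors [T3] and [T1]. *)
have cycle X : \tr (flip (al k) *m (T3 *m X *m T1)) = \tr (flip (al k) *m X).
  by rewrite mulmxA mxtrace_mulC !mulmxA T1K.
by rewrite -[T3 *m T2 *m P]mulmxA !cycle alk.
Qed.
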